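(* Let $a\in\mathbb{Z}H$, and let $A_H$ be the $(s\times n)$-matrix whose $i$th row is $v_i=(v_i(1),\ldots,v_i(n))$, $i=1,\ldots,s$. Let $l=\operatorname{rank}A_H$; let $l_a$ be the rank of the submatrix of $A_H$ whose rows are the $i$th rows of $A_H$ for which $a+h(v_i)\notin H$; and let $d_a$ be the rank of the submatrix of $A_H$ whose columns are the $j$th columns of $A_H$ for which $a+h_j\in H$. Then $$\dim_K T^1(K[H])_a=l-l_a-d_a.$$
   Context: $K$ is a field of characteristic $0$. $H\subset\mathbb{Z}^m$ is an affine semigroup (a finitely generated subsemigroup of $\mathbb{Z}^m$, containing $0$) with minimal generators $h_1,\ldots,h_n$; $\mathbb{Z}H$ is the subgroup of $\mathbb{Z}^m$ generated by $H$. $R=K[H]$ is the $K$-subalgebra of the Laurent polynomial ring $K[t_1^{\pm1},\ldots,t_m^{\pm1}]$ generated by $t^{h_1},\ldots,t^{h_n}$. $S=K[x_1,\ldots,x_n]$, with $\deg x_i=h_i$, and $I_H$ is the kernel of $S\to R$, $x_i\mapsto t^{h_i}$. The relation lattice $L\subset\mathbb{Z}^n$ is the kernel of $\mathbb{Z}^n\to\mathbb{Z}^m$, $\epsilon_i\mapsto h_i$ ($\epsilon_i$ the canonical basis). For $v\in\mathbb{Z}^n$ put $f_v=\prod_{v(i)\ge0}x_i^{v(i)}-\prod_{v(i)\le0}x_i^{-v(i)}$; for $v\in L$ put $h(v)=\sum_{v(i)\ge0}v(i)h_i$, which is the degree of $f_v$. The ideal $I_H$ is generated by the $f_v$, $v\in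 L$. Fix $v_1,\ldots,v_s\in L$ such that $f_{v_1},\ldots,f_{v_s}$ is a system of generators of $I_H$. Definition of $T^1$: let $\bigoplus_{i=1}^nR\,dx_i$ be the free graded $R$-module with $\deg dx_i=h_i$, and $U$ its submodule generated by the elements $df_v=\sum_{i=1}^nv(i)t^{h(v)-h_i}dx_i$, $v\in L$ (summands with $v(i)=0$ are $0$). With $M^*=\operatorname{Hom}_R(M,R)$, $T^1(R)$ is the cokernel of the restriction map $(\bigoplus_iR\,dx_i)^*\to U^*$; it is a $\mathbb{Z}H$-graded module, isomorphic to $\operatorname{Ext}^1_R(\Omega_{R/K},R)$. $T^1(R)_a$ is its component of degree $a$. *)

(* Defs.v *)
From HB Require Import structures.
From mathcomp Require Import all_boot all_order all_algebra.
From mathcomp Require Import generic_quotient ring_quotient finmap.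
From mathcomp Require Import mpoly monalg.
From mathcomp Require Import boolp functions.

Set Implicit Arguments.
Unset Strict Implicit.
Unset Printing Implicit Defensive.

Import Order.TTheory GRing.Theory Num.Theory.

Local Open Scope fset_scope.
Local Open Scope ring_scope.

(* The Laurent polynomial ring K[t_1^{+-1},...,t_m^{+-1}] is the group algebra of
   Z^m: finitely supported functions 'rV[int]_m -> K with convolution. The ring
   structure that monalg puts on {malg K[M]} is not available because it
   requires a monoid M without nontrivial units. *)
Definition laurent (K : comNzRingType) (m : nat) : Type := {malg K['rV[int]_m]}.

Section LaurentRing.
Variables (K : comNzRingType) (m : nat).
Local Notation L := (laurent K m).
Local Notation expo := ('rV[int]_m).

HB.instance Definition _ := GRing.Lmodule.copy L {malg K[expo]}.

Definition lterm (a : expo) (c : K) : L := mkmalgU a c.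

Definition lmono (a : expo) : L := lterm a 1.

Lemma ltermE (g : L) : g = \sum_(k <- msupp g) lterm k (mcoeff k g).
Proof. exact: monalgE. Qed.

Definition lmul (g1 g2 : L) : L :=
  \sum_(k1 <- msupp g1) \sum_(k2 <- msupp g2)
     lterm (k1 + k2) (mcoeff k1 g1 * mcoeff k2 g2).

Lemma lmulw (d1 d2 : {fset expo}) (g1 g2 : L) :
  msupp g1 `<=` d1 -> msupp g2 `<=` d2 ->
  lmul g1 g2 = \sum_(k1 <- d1) \sum_(k2 <- d2)
     lterm (k1 + k2) (mcoeff k1 g1 * mcoeff k2 g2).
Proof.
move=> le1 le2; rewrite /lmul (big_fset_incl _ le1) /=.
  apply/eq_bigr=> k1 _; apply/big_fset_incl => // k _ /mcoeff_outdom ->.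
  by rewrite mulr0 /lterm monalgU0.
move=> k _ /mcoeff_outdom g1k.
by rewrite big1 => // k' _; rewrite g1k mul0r /lterm monalgU0.
Qed.

Lemma lmulC : commutative lmul.
Proof.
move=> g1 g2; rewrite /lmul exchange_big; apply/eq_bigr=> k1 _.
by apply/eq_bigr=> k2 _; rewrite addrC mulrC.
Qed.

Lemma lmul0 : left_zero 0 lmul.
Proof. by move=> g; rewrite /lmul msupp0 big_seq_fset0. Qed.

Lemma lmulDl : left_distributive lmul +%R.
Proof.
move=> g1 g2 g.
rewrite (lmulw (msuppD_le g1 g2) (fsubset_refl _)).
rewrite (lmulw (fsubsetUl (msupp g1) (msupp g2)) (fsubset_refl _)).
rewrite (lmulw (fsubsetUr (msupp g1) (msupp g2)) (fsubset_refl _)).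
rewrite -big_split /=; apply/eq_bigr=> k1 _.
rewrite -big_split /=; apply/eq_bigr=> k2 _.
by rewrite mcoeffD mulrDl /lterm monalgUD.
Qed.

Lemma lmulUU (c1 c2 : K) (k1 k2 : expo) :
  lmul (lterm k1 c1) (lterm k2 c2) = lterm (k1 + k2) (c1 * c2).
Proof. by rewrite (lmulw msuppU_le msuppU_le) !big_seq_fset1 !mcoeffUU. Qed.

#[local] Opaque lmul lterm.

Lemma lmul_suml (g : L) (I : Type) (r : seq I) (F : I -> L) :
  lmul (\sum_(i <- r) F i) g = \sum_(i <- r) lmul (F i) g.
Proof.
exact: (big_morph (lmul^~ g) (fun x y => lmulDl x y g) (lmul0 g)).
Qed.

Lemma lmul_sumr (g : L) (I : Type) (r : seq I) (F : I -> L) :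
  lmul g (\sum_(i <- r) F i) = \sum_(i <- r) lmul g (F i).
Proof. by rewrite lmulC lmul_suml; apply/eq_bigr=> i _; rewrite lmulC. Qed.

Lemma lmulA : associative lmul.
Proof.
move=> g1 g2 g3.
rewrite (ltermE g1) !lmul_suml; apply/eq_bigr=> k1 _.
rewrite (ltermE g2) !(lmul_suml, lmul_sumr); apply/eq_bigr=> k2 _.
rewrite (ltermE g3) !lmul_sumr; apply/eq_bigr=> k3 _.
by rewrite !lmulUU addrA mulrA.
Qed.

Lemma lmul1 : left_id (lmono 0) lmul.
Proof.
move=> g; rewrite {1}(ltermE g) lmul_sumr [RHS]ltermE; apply/eq_bigr=> k _.
by rewrite lmulUU add0r mul1r.
Qed.

Lemma lscaleE (c : K) (g : L) : c *: g = lmul (lterm 0 c) g.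
Proof.
rewrite [in RHS](ltermE g) lmul_sumr; apply: eq_bigr=> k _.
by rewrite lmulUU add0r.
Qed.

Lemma lone_neq0 : lmono 0 != 0.
Proof. by rewrite monalgU_eq0 oner_eq0. Qed.

HB.instance Definition _ := GRing.Zmodule_isComNzRing.Build L
  lmulA lmulC lmul1 lmulDl lone_neq0.

Lemma lmulE (g1 g2 : L) : g1 * g2 = lmul g1 g2.
Proof. by []. Qed.

Lemma lscaleAl (c : K) (g1 g2 : L) : c *: (g1 * g2) = (c *: g1) * g2.
Proof. by rewrite !lscaleE lmulE lmulA. Qed.

HB.instance Definition _ := GRing.Lmodule_isLalgebra.Build K L lscaleAl.
HB.instance Definition _ := GRing.Lalgebra_isComAlgebra.Build K L.

Lemma lmonoD (a b : expo) : lmono (a + b) = lmono a * lmono b.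
Proof. by rewrite lmulE lmulUU mulr1. Qed.

Lemma lmono0 : lmono 0 = 1.
Proof. by []. Qed.

End LaurentRing.

Section ModuleConstructions.
Variable R : comNzRingType.

Section Span.
Variables (M : lmodType R) (X : M -> Prop).

Definition span_pred : {pred M} := fun u =>
  `[< forall P : {pred M},
        GRing.submod_closed P -> (forall x, X x -> x \in P) -> u \in P >].

Fact span_pred_closed : GRing.submod_closed span_pred.
Proof.
split=> [|c u w /asboolP uP /asboolP wP]; apply/asboolP=> P Pc XP.
  by case: Pc.
by case: (Pc) => _; apply; [apply: uP | apply: wP].
Qed.

HB.instance Definition _ :=
  GRing.isSubmodClosed.Build R M span_pred
    (GRing.submod_closed_semi span_pred_closed).

Record span := Span { span_val :> M; _ : span_val \in span_pred }.
HB.instance Definition _ := [isSub for span_val].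
HB.instance Definition _ := [Choice of span by <:].
HB.instance Definition _ := [SubChoice_isSubLmodule of span by <:].

End Span.

Section Dual.
Variable M : lmodType R.

Definition dual_pred : {pred M -> R^o} := fun f => `[< linear f >].

Fact dual_pred_closed : GRing.submod_closed dual_pred.
Proof.
split=> [|c f g /asboolP fl /asboolP gl]; apply/asboolP=> k u w.
  by rewrite scaler0 addr0.
have E z : (c *: f + g) z = c *: f z + g z by [].
by rewrite !E (fl k u w) (gl k u w) !scalerDr !scalerA (mulrC c) addrACA.
Qed.

HB.instance Definition _ :=
  GRing.isSubmodClosed.Build R (M -> R^o) dual_pred
    (GRing.submod_closed_semi dual_pred_closed).

Record dual := Dual { dual_val :> M -> R^o; _ : dual_val \in dual_pred }.
HB.instance Definition _ := [isSub for dual_val].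
HB.instance Definition _ := [Choice of dual by <:].
HB.instance Definition _ := [SubChoice_isSubLmodule of dual by <:].

Fact dual_linear (f : dual) : linear f.
Proof. by apply/asboolP; case: f. Qed.

End Dual.

Section DualMap.
Variables (M N : lmodType R) (j : {linear M -> N}).

Fact dual_map_subproof (f : dual N) : (f \o j : M -> R^o) \in @dual_pred M.
Proof.
by apply/asboolP=> k u w /=; rewrite linearP (dual_linear f).
Qed.

Definition dual_map (f : dual N) : dual M := Dual (dual_map_subproof f).

Fact dual_map_linear : linear dual_map.
Proof. by move=> k f g; apply/val_inj. Qed.

HB.instance Definition _ := GRing.isLinear.Build R (dual N) (dual M) *:%R
  dual_map dual_map_linear.

End DualMap.

Section Coker.
Variables (V W : lmodType R) (f : {linear V -> W}).

Definition im_pred : {pred W} := fun w => `[< exists u, w = f u >].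

Fact im_pred_closed : GRing.submod_closed im_pred.
Proof.
split=> [|c _ _ /asboolP[u ->] /asboolP[w ->]]; apply/asboolP.
  by exists 0; rewrite linear0.
by exists (c *: u + w); rewrite linearP.
Qed.

HB.instance Definition _ :=
  GRing.isSubmodClosed.Build R W im_pred
    (GRing.submod_closed_semi im_pred_closed).

Definition coker : Type := Quotient.quot im_pred.
HB.instance Definition _ := GRing.Zmodule.on coker.

Definition coker_pi (w : W) : coker := \pi_(Quotient.quot im_pred)%qT w.

Definition coker_scale (c : R) (x : coker) : coker :=
  coker_pi (c *: repr (x : Quotient.quot im_pred)).

Lemma coker_piP (w1 w2 : W) :
  coker_pi w1 = coker_pi w2 <-> exists u, w1 - w2 = f u.
Proof.
split=> [/eqP|h].
  by rewrite /coker_pi -Quotient.idealrBE => /asboolP.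
by apply/eqP; rewrite /coker_pi -Quotient.idealrBE; apply/asboolP.
Qed.

Lemma coker_surj (x : coker) : exists w, x = coker_pi w.
Proof.
by exists (repr (x : Quotient.quot im_pred)); rewrite /coker_pi reprK.
Qed.

Lemma coker_piD (w1 w2 : W) : coker_pi (w1 + w2) = coker_pi w1 + coker_pi w2.
Proof. exact: raddfD. Qed.

Lemma coker_scaleE (c : R) (w : W) :
  coker_scale c (coker_pi w) = coker_pi (c *: w).
Proof.
apply/coker_piP; set w' := repr _.
have /coker_piP[u def_u] : coker_pi w' = coker_pi w by rewrite /coker_pi reprK.
by exists (c *: u); rewrite -scalerBr def_u linearZ.
Qed.

Fact coker_scaleA c d (x : coker) :
  coker_scale c (coker_scale d x) = coker_scale (c * d) x.
Proof. by have [w ->] := coker_surj x; rewrite !coker_scaleE scalerA. Qed.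

Fact coker_scale1 : left_id 1 coker_scale.
Proof. by move=> x; have [w ->] := coker_surj x; rewrite coker_scaleE scale1r. Qed.

Fact coker_scaleDr : right_distributive coker_scale +%R.
Proof.
move=> c x y; have [w ->] := coker_surj x; have [z ->] := coker_surj y.
by rewrite -coker_piD !coker_scaleE -coker_piD scalerDr.
Qed.

Fact coker_scaleDl x : {morph coker_scale^~ x : c d / c + d}.
Proof.
move=> c d /=; have [w ->] := coker_surj x.
by rewrite !coker_scaleE -coker_piD scalerDl.
Qed.

HB.instance Definition _ := GRing.Zmodule_isLmodule.Build R coker
  coker_scaleA coker_scale1 coker_scaleDr coker_scaleDl.

Fact coker_pi_linear : linear coker_pi.
Proof. by move=> c w z; rewrite coker_piD -coker_scaleE. Qed.

HB.instance Definition _ := GRing.isLinear.Build R W coker *:%R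
  coker_pi coker_pi_linear.

End Coker.

End ModuleConstructions.

(* A K-subspace X of a module M over a K-algebra A (K acting through the scalars
   c%:A of A) has dimension d if it has a K-basis with d elements. *)
Definition has_dim (K : fieldType) (A : comAlgType K) (M : lmodType A)
    (X : M -> Prop) (d : nat) : Prop :=
  exists e : 'I_d -> M,
    (forall x, X x <-> exists c : 'I_d -> K, x = \sum_(i < d) (c i)%:A *: e i)
    /\ (forall c : 'I_d -> K,
          \sum_(i < d) (c i)%:A *: e i = 0 -> forall i, c i = 0).

Section Semigroup.
Variables (m n : nat) (h : 'I_n -> 'rV[int]_m).

Definition in_semigroup (a : 'rV[int]_m) : Prop :=
  exists c : 'I_n -> nat, a = \sum_(i < n) h i *+ c i.

Definition in_group (a : 'rV[int]_m) : Prop :=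
  exists c : 'I_n -> int, a = \sum_(i < n) h i *~ c i.

(* h_1, ..., h_n is irredundant: no proper subfamily generates H. *)
Definition minimal_generators : Prop :=
  forall I : {set 'I_n},
    (forall a, in_semigroup a ->
       exists c : 'I_n -> nat, a = \sum_(i in I) h i *+ c i) ->
    I = [set: 'I_n].

Definition relation_lattice (v : 'rV[int]_n) : Prop :=
  \sum_(i < n) h i *~ v 0 i = 0.

Definition rel_degree (v : 'rV[int]_n) : 'rV[int]_m :=
  \sum_(i < n | 0 <= v 0 i) h i *~ v 0 i.

Lemma rel_degree_semigroup (v : 'rV[int]_n) (i : 'I_n) :
  relation_lattice v -> v 0 i != 0 -> in_semigroup (rel_degree v - h i).
Proof.
move=> vL vi0.
pose neg (j : 'I_n) := if v 0 j <= 0 then absz (v 0 j) else 0%N.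
pose pos (j : 'I_n) := if 0 <= v 0 j then absz (v 0 j) else 0%N.
have degP : rel_degree v = \sum_(j < n) h j *+ pos j.
  rewrite /rel_degree big_mkcond; apply: eq_bigr => j _; rewrite /pos.
  by case: ifP => // vj; rewrite -{1}(gez0_abs vj).
have degN : rel_degree v = \sum_(j < n) h j *+ neg j.
  apply/eqP; rewrite degP -subr_eq0 -sumrB -[X in _ == X]vL; apply/eqP.
  apply: eq_bigr => j _; rewrite /pos /neg.
  by case: (v 0 j) => [[|k]|k] //=; rewrite ?mulr0n ?subr0 ?sub0r.
have subH (c : 'I_n -> nat) : (0 < c i)%N ->
    rel_degree v = \sum_(j < n) h j *+ c j -> in_semigroup (rel_degree v - h i).
  move=> ci0 ->; exists (fun j => c j - (j == i))%N.
  rewrite (bigD1 i) //= [RHS](bigD1 i) //= eqxx addrAC; congr (_ + _).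
    by rewrite subn1 -[in LHS](prednK ci0) mulrSr addrK.
  by apply: eq_bigr => j /negbTE->; rewrite subn0.
have [vi|vi] := leP 0 (v 0 i).
  by apply: (subH pos) => //; rewrite /pos vi absz_gt0.
by apply: (subH neg) => //; rewrite /neg ltW // absz_gt0.
Qed.

End Semigroup.

Definition binomial_of (K : fieldType) (n : nat) (v : 'rV[int]_n) :
    mpoly n K :=
  \prod_(i < n | 0 <= v 0 i) 'X_i ^+ absz (v 0 i)
  - \prod_(i < n | v 0 i <= 0) 'X_i ^+ absz (v 0 i).

Section SemigroupRing.
Variables (K : fieldType) (m n : nat) (h : 'I_n -> 'rV[int]_m).

Definition sgring_pred : {pred laurent K m} := fun x =>
  `[< forall P : {pred laurent K m}, GRing.subalg_closed P ->
        (forall i, lmono K (h i) \in P) -> x \in P >].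

Fact sgring_pred_closed : GRing.subalg_closed sgring_pred.
Proof.
split=> [|c x y /asboolP xP /asboolP yP|x y /asboolP xP /asboolP yP];
  apply/asboolP=> P Pc hP; case: (Pc) => P1 Plin PM //.
  by apply: Plin; [apply: xP | apply: yP].
by apply: PM; [apply: xP | apply: yP].
Qed.

HB.instance Definition _ :=
  GRing.isSubalgClosed.Build K (laurent K m) sgring_pred
    (GRing.subalg_closed_semi sgring_pred_closed).

Record sgring :=
  SgRing { sgring_val :> laurent K m; _ : sgring_val \in sgring_pred }.
HB.instance Definition _ := [isSub for sgring_val].
HB.instance Definition _ := [Choice of sgring by <:].
HB.instance Definition _ := [SubChoice_isSubAlgebra of sgring by <:].
HB.instance Definition _ := [SubNzRing_isSubComNzRing of sgring by <:].

(* t^a as an element of K[H]; the default value 0 is taken only when t^a is not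
   in K[H], that is, when a is not in H. *)
Definition sgmono (a : 'rV[int]_m) : sgring := insubd 0 (lmono K a).

Definition toric_map : mpoly n K -> sgring :=
  mpoly.mmap (in_alg sgring) (fun i => sgmono (h i)).

(* The binomials f_{v_1}, ..., f_{v_s} generate I_H = ker (S -> R). *)
Definition generates_toric_ideal (s : nat) (v : 'I_s -> 'rV[int]_n) : Prop :=
  forall p : mpoly n K,
    toric_map p = 0 <->
    exists c : 'I_s -> mpoly n K, p = \sum_(i < s) c i * binomial_of K (v i).

Lemma lmono_semigroup (a : 'rV[int]_m) :
  in_semigroup h a -> lmono K a \in sgring_pred.
Proof.
case=> c ->; rewrite (big_morph (@lmono K m) (@lmonoD K m) (lmono0 K m)).
apply: rpred_prod => i _; elim: (c i) => [|k IHk]; first exact: rpred1.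
rewrite mulrS lmonoD rpredM //; apply/asboolP=> P _; exact.
Qed.

Lemma sgmono_val (a : 'rV[int]_m) :
  in_semigroup h a -> sgring_val (sgmono a) = lmono K a.
Proof. by move/lmono_semigroup => aH; rewrite [LHS]insubdK. Qed.

(* The free module with basis dx_1, ..., dx_n is 'rV[sgring]_n. For v in L the
   exponents h(v) - h_i with v(i) != 0 lie in H (rel_degree_semigroup), and the
   coefficients with v(i) = 0 vanish. *)
Definition rel_differential (v : 'rV[int]_n) : 'rV[sgring]_n :=
  \row_(i < n) (sgmono (rel_degree h v - h i) *~ v 0 i).

Definition relation_module : lmodType sgring :=
  span (fun u : 'rV[sgring]_n =>
    exists v, relation_lattice h v /\ u = rel_differential v).

(* The cokernel of the restriction map (K[H]^n)^* -> U^*. *)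
Definition T1 : lmodType sgring :=
  coker (dual_map (val : relation_module -> 'rV[sgring]_n)).

(* The grading of K[H] (degree b part: K t^b if b is in H, else 0), of the free
   module with deg dx_i = h_i, and of homomorphisms U -> K[H]. *)
Definition sg_homog (b : 'rV[int]_m) (x : sgring) : Prop :=
  exists c : K, sgring_val x = lterm b c.

Definition free_homog (b : 'rV[int]_m) (u : 'rV[sgring]_n) : Prop :=
  forall i, sg_homog (b - h i) (u 0 i).

Definition dual_homog (a : 'rV[int]_m) (f : dual relation_module) : Prop :=
  forall (b : 'rV[int]_m) (u : relation_module),
    free_homog b (val u) -> sg_homog (a + b) (f u).

Definition T1_component (a : 'rV[int]_m) (x : T1) : Prop :=
  exists2 f : dual relation_module, dual_homog a f & x = coker_pi _ f.

End SemigroupRing.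

Definition relation_matrix (s n : nat) (v : 'I_s -> 'rV[int]_n) :
    'M[int]_(s, n) := \matrix_(i < s) v i.

Definition int_rank (p q : nat) (B : 'M[int]_(p, q)) : nat :=
  \rank (map_mx intr B : 'M[rat]_(p, q)).

Definition rows_of (p q : nat) (I : {set 'I_p}) (B : 'M[int]_(p, q)) :
    'M[int]_(#|I|, q) := rowsub (fun k : 'I_#|I| => enum_val k) B.

Definition cols_of (p q : nat) (J : {set 'I_q}) (B : 'M[int]_(p, q)) :
    'M[int]_(p, #|J|) := colsub (fun k : 'I_#|J| => enum_val k) B.

(* Main.v *)
Require Import Defs.
From HB Require Import structures.
From mathcomp Require Import all_boot all_order all_algebra.
From mathcomp Require Import finmap monalg mpoly boolp zify ring.

(* A degree-a element of U^* is f(u) = sum_j w_j t^(a + h_j) u_j for some w in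
   K^n. Such an f sends df_(v_i) to (v_i . w) t^(a + h(v_i)), so it takes values
   in K[H] iff v_i . w = 0 whenever a + h(v_i) is not in H, and it depends only
   on A_H w. Every homogeneous f arises: the coefficients mu_i of f(df_(v_i))
   satisfy every linear relation among the rows of A_H, because a relation
   sum_i c_i v_i = 0 lifts to sum_i c_i t^(b - h(v_i)) df_(v_i) = 0 with
   b = sum_k h(v_k). The restrictions of degree-a functionals on the free module
   are those with w supported on the set J of all j such that a + h_j is in H.
   Hence T^1_a is the quotient of {A_H w | (A_H w)_i = 0 if a + h(v_i) notin H},
   of dimension l - l_a, by {A_H w | supp w in J}, of dimension d_a. *)

Set Implicit Arguments.
Unset Strict Implicit.
Unset Printing Implicit Defensive.

Import GRing.Theory Num.Theory.
Local Open Scope ring_scope.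

(** * Ranks *)

Section RankOfIntegerMatrix.
Variables (K : fieldType) (charK0 : [pchar K] =i pred0).

Lemma intr_eq0_pchar0 (z : int) : (z%:~R == 0 :> K) = (z == 0).
Proof.
have natr0 k : (k%:R == 0 :> K) = (k == 0)%N by have /pcharf0P -> := charK0.
by case: z => k; rewrite ?NegzE ?mulrNz ?oppr_eq0 -?pmulrn natr0.
Qed.

Let denK0 (x : rat) : (denq x)%:~R != 0 :> K.
Proof. by rewrite intr_eq0_pchar0 denq_neq0. Qed.

(** [ratr] is defined through the reduced fraction. Since nonzero integers stay nonzero in K, any
    other fraction gives the same value, which makes [ratr] a ring morphism. *)
Lemma ratr_frac_pchar0 (x : rat) (d e : int) : e != 0 ->
  x * e%:~R = d%:~R -> ratr x = d%:~R / e%:~R :> K.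
Proof.
move=> e0 xE; rewrite /ratr.
have e0K : e%:~R != 0 :> K by rewrite intr_eq0_pchar0.
apply/eqP; rewrite eqr_div // -!intrM; apply/eqP; congr (_%:~R).
by apply: (@intr_inj rat); rewrite !intrM -xE numqE mulrAC.
Qed.

Lemma ratr_zmod_morphism_pchar0 : zmod_morphism (@ratr K).
Proof.
move=> x y.
rewrite (@ratr_frac_pchar0 (x - y) (numq x * denq y - numq y * denq x)
  (denq x * denq y)).
- by rewrite /ratr intrB !intrM; field; rewrite !denK0.
- by rewrite mulf_neq0 ?denq_neq0.
by rewrite intrB !intrM !numqE; ring.
Qed.

Lemma ratr_monoid_morphism_pchar0 : monoid_morphism (@ratr K).
Proof.
split=> [|x y]; first by rewrite /ratr divr1.
rewrite (@ratr_frac_pchar0 (x * y) (numq x * numq y) (denq x * denq y)).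
- by rewrite /ratr !intrM mulf_div.
- by rewrite mulf_neq0 ?denq_neq0.
by rewrite !intrM !numqE mulrACA.
Qed.

(** In characteristic 0, [ratr] embeds the rationals into K, and rank is invariant under field
    extension. *)
Lemma mxrank_intr_pchar0 p q (B : 'M[int]_(p, q)) :
  \rank (map_mx intr B : 'M[K]_(p, q)) = int_rank B.
Proof.
pose zM := GRing.isZmodMorphism.Build rat K _ ratr_zmod_morphism_pchar0.
pose mM := GRing.isMonoidMorphism.Build rat K _ ratr_monoid_morphism_pchar0.
pose f : {rmorphism rat -> K} := HB.pack (@ratr K) zM mM.
rewrite /int_rank -(mxrank_map f) -map_mx_comp; congr (\rank _).
by apply/matrixP=> i j; rewrite !mxE /= ratr_int.
Qed.

End RankOfIntegerMatrix.

(** Rank-nullity for [D] restricted to the row space of [N]: the kernel there is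
    [kermx (N *m D) *m N] and the image is [N *m D]. *)
Lemma mxrank_kermx_submul (F : fieldType) n s p (N : 'M[F]_(n, s))
    (D : 'M[F]_(s, p)) :
  (\rank (kermx (N *m D) *m N) + \rank (N *m D) = \rank N)%N.
Proof.
have := mxrank_mul_ker (kermx (N *m D)) N.
rewrite (capmx_idPr _); last first.
  by apply/sub_kermxP; rewrite mulmxA mulmx_ker mul0mx.
rewrite !mxrank_ker => E.
have := rank_leq_row N; have := rank_leq_row (N *m D); have := mxrankM_maxl N D.
move: E; move: (\rank _) (\rank _) (\rank _) => x y z; lia.
Qed.

Lemma sub_rowsubP (F : fieldType) n s (J : {set 'I_n}) (N : 'M[F]_(n, s))
    (x : 'rV_s) :
  reflect (exists2 w : 'rV_n, (forall j, j \notin J -> w 0 j = 0) & x = w *m N)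
    (x <= rowsub (fun k : 'I_#|J| => enum_val k) N)%MS.
Proof.
apply: (iffP submxP) => [[z ->]|[w wJ ->]].
  (* This vector is [z] extended by zero outside [J]. *)
  exists (z *m rowsub (fun k : 'I_#|J| => enum_val k) 1%:M); last first.
    by rewrite -mulmxA -rowsubE.
  move=> j jJ; rewrite mxE big1 // => k _; rewrite !mxE.
  by case: eqP => [kj|_]; [rewrite -kj enum_valP in jJ | rewrite mulr0].
exists (\row_k w 0 (enum_val k)); apply/rowP=> i; rewrite !mxE.
rewrite (bigID (mem J)) /= [X in _ + X]big1 ?addr0 => [|j /wJ->]; last first.
  by rewrite mul0r.
rewrite (big_enum_val (fun j => w 0 j * N j i)) /=.
by apply: eq_bigr => k _; rewrite !mxE.
Qed.

Lemma row_free_comb0 (F : fieldType) d s (B : 'M[F]_(d, s)) (c : 'rV_d) :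
  row_free B -> c *m B = 0 -> c = 0.
Proof.
case/row_freeP=> C BC /(congr1 (mulmx^~ C)).
by rewrite -mulmxA BC mulmx1 mul0mx.
Qed.

Lemma mxrank_diff_sub (F : fieldType) p q s (A : 'M[F]_(p, s)) (B : 'M[F]_(q, s)) :
  (B <= A)%MS -> (\rank (A :\: B) + \rank B = \rank A)%N.
Proof.
move=> BA; have := mxrank_cap_compl A B.
by rewrite (capmx_idPr BA) addnC.
Qed.

(** * The dimension count as an identity between ranks *)

Section RankFormula.
Variables (K : fieldType) (s n : nat) (A : 'M[K]_(s, n)).
Variables (I : {set 'I_s}) (J : {set 'I_n}).

(** A selection matrix turns the vanishing conditions at the indices in [I] into a kernel
    condition. *)
Definition sel_cols := colsub (fun k : 'I_#|I| => enum_val k) (1%:M : 'M[K]_s).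

Lemma sel_colsP p (B : 'M[K]_(p, s)) :
  (B *m sel_cols = 0) <-> forall i k, k \in I -> B i k = 0.
Proof.
rewrite /sel_cols -[B *m _]/(B *m colsub _ 1%:M) mulmx_colsub mulmx1.
split=> [/matrixP B0 i k kI|B0].
  by have := B0 i (enum_rank_in kI k); rewrite !mxE enum_rankK_in.
by apply/matrixP=> i k; rewrite !mxE B0 ?enum_valP.
Qed.

Lemma mxrank_sel_cols :
  \rank (A^T *m sel_cols) = \rank (rowsub (fun k : 'I_#|I| => enum_val k) A).
Proof.
rewrite /sel_cols mulmx_colsub mulmx1 -mxrank_tr; congr (\rank _).
by apply/matrixP=> i j; rewrite !mxE.
Qed.

Hypothesis IJ0 : forall i j, i \in I -> j \in J -> A i j = 0.

Lemma rowsub_sub_kermx :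
  (rowsub (fun k : 'I_#|J| => enum_val k) A^T <=
   kermx (A^T *m sel_cols) *m A^T)%MS.
Proof.
rewrite rowsubE submxMr //; apply/sub_kermxP.
rewrite mulmxA -rowsubE; apply/sel_colsP=> k i iI.
by rewrite !mxE IJ0 ?enum_valP.
Qed.

(** Rank-nullity splits off the rows in [I]. The columns in [J] span a subspace of the remaining
    kernel because the [I]-by-[J] block of [A] is zero, so their rank splits off as well. *)
Lemma mxrank_diff_formula :
  (\rank ((kermx (A^T *m sel_cols) *m A^T)
     :\: rowsub (fun k : 'I_#|J| => enum_val k) A^T)
   + \rank (rowsub (fun k : 'I_#|I| => enum_val k) A)
   + \rank (colsub (fun k : 'I_#|J| => enum_val k) A) = \rank A)%N.
Proof.
rewrite -(mxrank_tr A) -(mxrank_kermx_submul A^T sel_cols) -mxrank_sel_cols.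
rewrite -(mxrank_diff_sub rowsub_sub_kermx) addnAC; congr (_ + _ + _)%N.
rewrite -mxrank_tr; congr (\rank _).
by apply/matrixP=> i j; rewrite !mxE.
Qed.

End RankFormula.

(** * Spans and duals *)

Section SpanInduction.
Variables (R : comNzRingType) (M : lmodType R) (X : M -> Prop).

Lemma mem_span x : X x -> x \in span_pred X.
Proof. by move=> Xx; apply/asboolP=> P _; apply. Qed.

(** Induction from a smaller generating set [Y]: it will reduce claims on U, spanned by all df_v, to
    the finitely many df_(v_i). *)
Lemma span_ind_gen (Y : M -> Prop) (YX : forall y, Y y -> X y)
    (XY : forall x, X x -> x \in span_pred Y) (phi : Defs.span X -> Prop) :
  phi 0 ->
  (forall c u w, phi u -> phi w -> phi (c *: u + w)) ->
  (forall y (Yy : Y y), phi (Span (mem_span (YX y Yy)))) ->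
  forall u, phi u.
Proof.
move=> phi0 phiP phiY u.
(* [phi] lives on the subtype, whereas span membership quantifies over predicates on [M], so [phi]
   is transported along [val]. *)
pose P : {pred M} := fun x => `[< exists2 w : Defs.span X, val w = x & phi w >].
have Pclosed : GRing.submod_closed P.
  split=> [|c x y /asboolP[u1 <- phi1] /asboolP[u2 <- phi2]]; apply/asboolP.
    by exists 0; rewrite ?raddf0.
  by exists (c *: u1 + u2); [rewrite linearP | exact: phiP].
have PY y : Y y -> y \in P.
  by move=> Yy; apply/asboolP; exists (Span (mem_span (YX y Yy))).
have /asboolP uX := valP u.
have /asboolP[w /val_inj <- //] : val u \in P.
apply: uX => // x /XY /asboolP; exact.
Qed.

End SpanInduction.

Lemma dual0 (R : comNzRingType) (M : lmodType R) (f : dual M) : f 0 = 0.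
Proof. by have := dual_linear f (-1) 0 0; rewrite scaler0 addr0 scaleN1r addNr. Qed.

Lemma dual_sum (R : comNzRingType) (M : lmodType R) (f : dual M) (I : Type)
    (r : seq I) (x : I -> R) (u : I -> M) :
  f (\sum_(i <- r) x i *: u i) = \sum_(i <- r) x i * f (u i).
Proof.
elim: r => [|i r IH]; first by rewrite !big_nil dual0.
by rewrite !big_cons (dual_linear f) IH.
Qed.

Lemma coker_pi_sum (R : comNzRingType) (V W : lmodType R) (f : {linear V -> W})
    d (x : 'I_d -> R) (w : 'I_d -> W) :
  coker_pi f (\sum_i x i *: w i) = \sum_i x i *: coker_pi f (w i).
Proof. by rewrite linear_sum; apply: eq_bigr => i _; rewrite linearZ. Qed.

(** * The semigroup ring and its binomial relations *)

Section LaurentCoefficients.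
Variables (K : fieldType) (m : nat).
Local Notation L := (laurent K m).
Implicit Types (x y : L) (a b : 'rV[int]_m).

Fact lterm_zmod_morphism a : zmod_morphism (@lterm K m a).
Proof. exact: monalgUB. Qed.

HB.instance Definition _ a :=
  GRing.isZmodMorphism.Build K L (@lterm K m a) (lterm_zmod_morphism a).

Lemma ltermZ a (c d : K) : lterm a (c * d) = c *: lterm a d :> L.
Proof. by rewrite lscaleE lmulUU add0r. Qed.

Lemma mcoeff_lterm a b (c : K) : monalg.mcoeff b (lterm a c) = c *+ (a == b).
Proof. exact: monalg.mcoeffU. Qed.

Lemma mcoeff_lmonoM a b x :
  monalg.mcoeff (a + b) (lmono K a * x) = monalg.mcoeff b x.
Proof.
rewrite (ltermE x) mulr_sumr !raddf_sum; apply: eq_bigr => k _.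
by rewrite /= lmulE lmulUU mul1r !mcoeff_lterm (inj_eq (addrI a)).
Qed.

End LaurentCoefficients.

Section SemigroupAlgebra.
Variables (K : fieldType) (m n : nat) (h : 'I_n -> 'rV[int]_m).
Local Notation R := (sgring K h).
Local Notation H := (in_semigroup h).
Local Notation mono := (sgmono K h).

Lemma in_semigroup0 : H 0.
Proof. by exists (fun=> 0%N); rewrite big1. Qed.

Lemma in_semigroupD a b : H a -> H b -> H (a + b).
Proof.
move=> [c ->] [d ->]; exists (fun i => c i + d i)%N.
by rewrite -big_split; apply: eq_bigr => i _; rewrite mulrnDr.
Qed.

Lemma in_semigroup_gen i : H (h i).
Proof.
exists (fun j => (j == i) : nat); rewrite (bigD1 i) //= eqxx big1 ?addr0 //.
by move=> j /negbTE->.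
Qed.

Lemma in_semigroup_sum (I : Type) (r : seq I) (P : pred I) (F : I -> 'rV_m) :
  (forall i, P i -> H (F i)) -> H (\sum_(i <- r | P i) F i).
Proof.
by move=> HF; elim/big_ind: _ => //; [exact: in_semigroup0 | exact: in_semigroupD].
Qed.

Lemma sgring_valP (x : R) : sgring_val x \in sgring_pred h.
Proof. by case: x. Qed.

Lemma sgval_inj : injective (@sgring_val K m n h).
Proof. exact: val_inj. Qed.

Lemma sgval_linear : linear (@sgring_val K m n h).
Proof. by move=> c x y; rewrite -[sgring_val _]/(val _) linearP. Qed.

HB.instance Definition _ :=
  GRing.isLinear.Build K R (laurent K m) *:%R (@sgring_val K m n h) sgval_linear.

Lemma sgval_monoid_morphism : monoid_morphism (@sgring_val K m n h).
Proof. by []. Qed.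

HB.instance Definition _ :=
  GRing.isMonoidMorphism.Build R (laurent K m) (@sgring_val K m n h)
    sgval_monoid_morphism.

Lemma sgvalM (x y : R) : sgring_val (x * y) = sgring_val x * sgring_val y.
Proof. exact: (rmorphM (@sgring_val K m n h)). Qed.

(** The Laurent polynomials with support in H form a subalgebra containing every t^(h_i), hence
    containing K[H]. *)
Lemma sgring_supp (x : R) b : monalg.mcoeff b (sgring_val x) != 0 -> H b.
Proof.
pose P : {pred laurent K m} :=
  fun g => `[< forall b, monalg.mcoeff b g != 0 -> H b >].
have Pclosed : GRing.subalg_closed P.
  split=> [|c y z /asboolP yP /asboolP zP|y z /asboolP yP /asboolP zP];
    apply/asboolP=> {}b.
  - rewrite -lmono0 mcoeff_lterm; case: (0 =P b) => [<- _|].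
      exact: in_semigroup0.
    by rewrite eqxx.
  - rewrite monalg.mcoeffD monalg.mcoeffZ.
    have [->|/yP//] := eqVneq (monalg.mcoeff b y) 0.
    by rewrite mulr0 add0r => /zP.
  have [//|nHb] := pselect (H b).
  rewrite lmulE /lmul raddf_sum /= big_seq big1 ?eqxx // => k1 k1y.
  rewrite raddf_sum big_seq big1 // => k2 k2z.
  rewrite /= mcoeff_lterm; case: (_ =P b) => // kb; case: nHb; rewrite -kb.
  by apply: in_semigroupD; [apply: yP | apply: zP]; rewrite monalg.mcoeff_neq0.
suff /asboolP : sgring_val x \in P by apply.
have /asboolP xP := valP x; apply: xP => // i.
apply/asboolP=> {}b; rewrite mcoeff_lterm; case: (_ =P b) => [<- _|].
  exact: in_semigroup_gen.
by rewrite eqxx.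
Qed.

Lemma mcoeff_sgring_out (x : R) b : ~ H b -> monalg.mcoeff b (sgring_val x) = 0.
Proof. by move=> nHb; apply/eqP/negPn/negP=> /sgring_supp. Qed.

Lemma val_sgmono a : H a -> sgring_val (mono a) = lmono K a.
Proof. exact: sgmono_val. Qed.

#[local] Opaque sgmono.

Lemma sgmono0 : mono 0 = 1.
Proof. by apply: sgval_inj; rewrite val_sgmono ?rmorph1 //; apply: in_semigroup0. Qed.

Lemma sgmonoD a b : H a -> H b -> mono (a + b) = mono a * mono b.
Proof.
move=> Ha Hb; apply: sgval_inj.
apply: etrans (val_sgmono (in_semigroupD Ha Hb)) _.
rewrite [LHS]lmonoD -(val_sgmono Ha) -(val_sgmono Hb).
exact: esym (sgvalM _ _).
Qed.

Lemma toric_mapX (k : 'X_{1..n}) :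
  toric_map h 'X_[k] = mono (\sum_(i < n) h i *+ k i).
Proof.
have HMn i j : H (h i *+ j).
  elim: j => [|j IH]; first exact: in_semigroup0.
  by rewrite mulrS; apply: in_semigroupD => //; apply: in_semigroup_gen.
rewrite /toric_map mmapX /mmap1.
(* Membership in H is carried through the induction, since [sgmono] is multiplicative only on H. *)
suff [-> //] : \prod_(i < n) mono (h i) ^+ k i = mono (\sum_(i < n) h i *+ k i)
   /\ H (\sum_(i < n) h i *+ k i).
elim/big_rec2: _ => [|i x y _ [-> Hx]].
  by rewrite sgmono0; split=> //; exact: in_semigroup0.
split; last exact: in_semigroupD.
rewrite sgmonoD //; congr (_ * _); elim: (k i) => [|j IH].
  by rewrite expr0 mulr0n sgmono0.
by rewrite exprS mulrS sgmonoD ?IH //; apply: in_semigroup_gen.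
Qed.

(** * Binomials and their differentials over K[H] *)

HB.instance Definition _ := GRing.RMorphism.copy (toric_map h)
  (mmap (in_alg R) (fun i => mono (h i))).

Definition pos_exp (v : 'rV[int]_n) : 'X_{1..n} :=
  [multinom (if (0 <= v 0 i)%R then absz (v 0%R i) else 0%N) | i < n].
Definition neg_exp (v : 'rV[int]_n) : 'X_{1..n} :=
  [multinom (if (v 0 i <= 0)%R then absz (v 0%R i) else 0%N) | i < n].

Lemma binomial_ofE v : binomial_of K v = 'X_[pos_exp v] - 'X_[neg_exp v].
Proof.
rewrite /binomial_of !mpolyXE_id.
by congr (_ - _); rewrite big_mkcond; apply: eq_bigr => i _; rewrite mnmE;
  case: ifP.
Qed.

Lemma rel_degree_pos v : \sum_(i < n) h i *+ pos_exp v i = rel_degree h v.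
Proof.
rewrite /rel_degree [RHS]big_mkcond; apply: eq_bigr => i _; rewrite mnmE.
by case: ifP => // vi; rewrite -{2}(gez0_abs vi).
Qed.

Lemma pos_neg_exp v i : (pos_exp v i)%:Z - (neg_exp v i)%:Z = v 0 i.
Proof. by rewrite !mnmE; case: (ltrgt0P (v 0 i)); lia. Qed.

Lemma rel_degree_neg v : relation_lattice h v ->
  \sum_(i < n) h i *+ neg_exp v i = rel_degree h v.
Proof.
move=> vL; apply/eqP; rewrite -rel_degree_pos eq_sym -subr_eq0 -sumrB.
apply/eqP; rewrite -[RHS]vL; apply: eq_bigr => i _.
by rewrite -(pos_neg_exp v i) mulrzBr.
Qed.

Lemma rel_degree_in v : H (rel_degree h v).
Proof. by exists (pos_exp v); rewrite rel_degree_pos. Qed.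

Lemma toric_binomial v : relation_lattice h v ->
  toric_map h (binomial_of K v) = 0.
Proof.
move=> vL; rewrite binomial_ofE rmorphB /= !toric_mapX rel_degree_pos.
by rewrite rel_degree_neg // subrr.
Qed.

Lemma toric_mderivX (k : 'X_{1..n}) j :
  toric_map h ('X_[k]^`M(j)) =
  mono (\sum_(i < n) h i *+ k i - h j) *+ k j.
Proof.
have kE : (0 < k j)%N ->
    \sum_(i < n) h i *+ (k - U_(j))%MM i = \sum_(i < n) h i *+ k i - h j.
  move=> kj; rewrite (bigD1 j) //= [in RHS](bigD1 j) //= addrAC.
  rewrite mnmBE mnm1E eqxx subn1 -{2}(prednK kj) mulrSr addrK; congr (_ + _).
  by apply: eq_bigr => i ij; rewrite mnmBE mnm1E eq_sym (negbTE ij) subn0.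
rewrite mderivX scaler_nat rmorphMn /= toric_mapX.
(* If k_j = 0, the exponent on the right may leave H, but the factor k_j annihilates both sides. *)
have [k0|/kE <- //] := posnP (k j).
rewrite k0.
exact: etrans (mulr0n _) (esym (mulr0n _)).
Qed.

(** This identifies df_v with the gradient of f_v read in K[H]; both monomials of f_v have degree
    h(v), so their derivatives combine into one term. *)
Lemma toric_mderiv_binomial v j : relation_lattice h v ->
  toric_map h ((binomial_of K v)^`M(j)) = rel_differential K h v 0 j.
Proof.
move=> vL; rewrite binomial_ofE mderivB rmorphB /= !toric_mderivX.
rewrite rel_degree_pos rel_degree_neg // !pmulrn -mulrzBr pos_neg_exp.
by rewrite mxE.
Qed.

Variables (s : nat) (v : 'I_s -> 'rV[int]_n).
Hypothesis vL : forall i, relation_lattice h (v i).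
Hypothesis vgen : generates_toric_ideal K h v.

(** Differentiate an expression of f_w through the f_(v_i): by the product rule, the terms that
    still contain some f_(v_i) vanish in K[H]. *)
Lemma rel_differential_gen w : relation_lattice h w ->
  exists c : 'I_s -> R,
    rel_differential K h w = \sum_(i < s) c i *: rel_differential K h (v i).
Proof.
move=> wL; have /vgen[c wE] := toric_binomial wL.
exists (fun i => toric_map h (c i)); apply/rowP=> j.
rewrite -toric_mderiv_binomial // wE (raddf_sum (mderiv j)) raddf_sum /= summxE.
apply: eq_bigr => i _; rewrite mderivM rmorphD !rmorphM /=.
by rewrite toric_binomial // mulr0 add0r toric_mderiv_binomial // !mxE.
Qed.

Lemma val_rel_differential w j : relation_lattice h w ->
  sgring_val (rel_differential K h w 0 j) =
  lterm (rel_degree h w - h j) (w 0 j)%:~R :> laurent K m.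
Proof.
move=> wL; rewrite mxE raddfMz /=.
have [->|wj] := eqVneq (w 0 j) 0.
  by rewrite !mulr0z raddf0.
rewrite val_sgmono; last exact: rel_degree_semigroup.
by rewrite -raddfMz.
Qed.

(** * Functionals of degree [a] on the relation module *)

Local Notation U := (relation_module K h).
Local Notation drel := (rel_differential K h).
Local Notation deg := (rel_degree h).
Variable a : 'rV[int]_m.

(** The values are taken in the Laurent ring because t^(a + h_j) need not lie in K[H]. *)
Definition pairing (w : 'rV[K]_n) (x : 'rV[R]_n) : laurent K m :=
  \sum_(j < n) lterm (a + h j) (w 0 j) * sgring_val (x 0 j).

Lemma pairing_linearr w (c : R) x y :
  pairing w (c *: x + y) = sgring_val c * pairing w x + pairing w y.
Proof.
rewrite /pairing mulr_sumr -big_split; apply: eq_bigr => j _ /=.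
by rewrite !mxE raddfD /= mulrDr mulrCA.
Qed.

Lemma pairing_linearl (c : K) w z x :
  pairing (c *: w + z) x = c *: pairing w x + pairing z x.
Proof.
rewrite /pairing scaler_sumr -big_split; apply: eq_bigr => j _ /=.
by rewrite !mxE raddfD mulrDl /= ltermZ -scalerAl.
Qed.

Lemma pairing0 w : pairing w 0 = 0.
Proof.
by rewrite /pairing big1 // => j _; rewrite mxE raddf0 mulr0.
Qed.

Lemma pairing_homog w b x : free_homog b x ->
  exists c, pairing w x = lterm (a + b) c.
Proof.
move=> xb; have [c cE] := choice xb.
exists (\sum_j w 0 j * c j); rewrite /pairing raddf_sum.
apply: eq_bigr => j _.
by rewrite /= cE lmulE lmulUU addrACA subrr addr0.
Qed.

Lemma pairing_rel w z : relation_lattice h z ->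
  pairing w (drel z) =
  lterm (a + rel_degree h z) (\sum_j w 0 j * (z 0 j)%:~R).
Proof.
move=> zL; rewrite /pairing raddf_sum; apply: eq_bigr => j _.
rewrite val_rel_differential // lmulE lmulUU; congr (lterm _ _).
by rewrite addrACA subrr addr0.
Qed.

(** A relation rather than a function of [w]: the pairing may leave K[H], and different [w] may give
    the same functional on U. *)
Definition represents (w : 'rV[K]_n) (f : dual U) : Prop :=
  forall u : U, sgring_val (f u) = pairing w (val u).

Lemma represents_linear (c : K) w z f g : represents w f -> represents z g ->
  represents (c *: w + z) (c%:A *: f + g).
Proof.
move=> wf zg u; rewrite pairing_linearl -wf -zg.
rewrite [(_ + g) u]/(c%:A * f u + g u) -scalerAl mul1r.
exact: sgval_linear.
Qed.

Lemma represents0 : represents 0 0.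
Proof.
move=> u; rewrite /pairing big1 ?raddf0 //.
by move=> j _; rewrite mxE raddf0 mul0r.
Qed.

Lemma represents_sum d (c : 'I_d -> K) w f :
  (forall i, represents (w i) (f i)) ->
  represents (\sum_i c i *: w i) (\sum_i (c i)%:A *: f i).
Proof.
move=> wf; elim/big_rec2: _ => [|i g z _ zg]; first exact: represents0.
exact (represents_linear (c i) (wf i) zg).
Qed.

Lemma represents_homog w f : represents w f -> dual_homog a f.
Proof. by move=> wf b u /(pairing_homog w)[c cE]; exists c; rewrite -cE -wf. Qed.

Definition rel_gen i : U :=
  Span (mem_span (ex_intro _ (v i) (conj (vL i) erefl))).

Lemma relation_module_ind (phi : U -> Prop) :
  phi 0 ->
  (forall c u w, phi u -> phi w -> phi (c *: u + w)) ->
  (forall i, phi (rel_gen i)) ->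
  forall u, phi u.
Proof.
move=> phi0 phiP phiG.
apply: (@span_ind_gen _ _ _ (fun x => exists i, x = drel (v i))) => //.
- by move=> _ [i ->]; exists (v i).
- move=> _ [w [wL ->]]; have [c ->] := rel_differential_gen wL.
  apply: rpred_sum => i _; apply: rpredZ; apply: mem_span; by exists i.
move=> YX y Yy; have [i yE] := Yy.
by rewrite (_ : Span _ = rel_gen i) //; apply: val_inj.
Qed.

Local Notation N := ((map_mx intr (relation_matrix v))^T : 'M[K]_(n, s)).

Lemma pairing_gen w i :
  pairing w (drel (v i)) = lterm (a + deg (v i)) ((w *m N) 0 i).
Proof.
rewrite (pairing_rel w (vL i)); congr (lterm _ _).
by rewrite mxE; apply: eq_bigr => j _; rewrite !mxE.
Qed.

Lemma representsE w (f : dual U) : represents w f <->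
  forall i, sgring_val (f (rel_gen i)) = lterm (a + deg (v i)) ((w *m N) 0 i).
Proof.
split=> [wf i|wf]; first by rewrite wf pairing_gen.
apply: relation_module_ind => [|c u z uE zE|i].
- by rewrite dual0 raddf0 pairing0.
- rewrite (dual_linear f) raddfD /= uE zE.
  exact: esym (pairing_linearr _ _ _ _).
by rewrite wf -pairing_gen.
Qed.

Lemma represents_uniq w z (f g : dual U) : represents w f -> represents z g ->
  w *m N = z *m N -> f = g.
Proof.
move=> /representsE wf zg wz; apply/val_inj/funext=> u; apply: sgval_inj.
rewrite [RHS]zg; move: u; apply/representsE=> i.
by rewrite wf wz.
Qed.

(** The hypothesis removes exactly the values on generators that would leave K[H]; linearity then
    keeps the pairing inside K[H] on all of U. *)
Lemma represents_ex w :
  (forall i, ~ H (a + deg (v i)) -> (w *m N) 0 i = 0) ->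
  exists f : dual U, represents w f.
Proof.
move=> wH.
have wR (u : U) : pairing w (val u) \in sgring_pred h.
  move: u; apply: relation_module_ind => [|c u z uR zR|i].
  - by rewrite pairing0 rpred0.
  - have -> : val (c *: u + z) = c *: val u + val z by exact: linearP.
    rewrite pairing_linearr; apply: rpredD zR; apply: rpredM uR; exact: valP.
  rewrite pairing_gen; have [aH|/wH->] := pselect (H (a + deg (v i))).
    rewrite -[X in lterm _ X]mulr1 ltermZ rpredZ //; exact: lmono_semigroup.
  by rewrite raddf0 rpred0.
pose f (u : U) : R^o := SgRing (wR u).
have fP : f \in @dual_pred _ U.
  apply/asboolP=> c u z; apply: sgval_inj.
  by rewrite raddfD /= pairing_linearr.
by exists (Dual fP).
Qed.

(** The exponent is b - h(v_i) with b the sum of all h(v_k), written without subtraction so that it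
    visibly lies in H. *)
Let syz_coef (c : 'cV[K]_s) i : R :=
  (c i 0)%:A * mono (\sum_(k < s | k != i) deg (v k)).

Let syz_coefE (c : 'cV[K]_s) i :
  sgring_val (syz_coef c i) = lterm (\sum_(k < s) deg (v k) - deg (v i)) (c i 0).
Proof.
rewrite /syz_coef -scalerAl mul1r [LHS]linearZ /= val_sgmono; last first.
  by apply: in_semigroup_sum => k _; apply: rel_degree_in.
rewrite [in RHS](bigD1 i) //= [deg (v i) + _]addrC addrK.
by rewrite -[X in lterm _ X]mulr1 ltermZ.
Qed.

(** In coordinate j every summand is a multiple of t^(b - h_j), and the coefficients add up to the
    j-th entry of [N *m c]. *)
Lemma rel_gen_syzygy (c : 'cV[K]_s) : N *m c = 0 ->
  \sum_(i < s) syz_coef c i *: rel_gen i = 0.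
Proof.
move=> Nc; apply: val_inj; rewrite raddf_sum; apply/rowP=> j.
apply: sgval_inj; rewrite summxE mxE !raddf_sum.
pose B := \sum_k deg (v k).
transitivity (lterm (B - h j) ((N *m c) j 0) : laurent K m); last first.
  by rewrite Nc mxE !raddf0.
rewrite mxE raddf_sum; apply: eq_bigr => i _.
rewrite [_ 0 j]mxE [LHS]sgvalM syz_coefE val_rel_differential //.
by rewrite lmulE lmulUU addrA subrK !mxE mulrC.
Qed.

Lemma homog_represents (f : dual U) :
  dual_homog a f -> exists w, represents w f.
Proof.
move=> fa.
have genH i : free_homog (deg (v i)) (val (rel_gen i)).
  by move=> j; exists (v i 0 j)%:~R; apply: val_rel_differential.
pose B := \sum_k deg (v k).
have [mu muE] := choice (fun i => fa _ _ (genH i)).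
pose x : 'rV[K]_s := \row_i mu i.
(* Row space membership is tested on the columns of [cokermx N]; each is a linear relation among the
   rows of A_H and lifts to a syzygy. *)
have xN : (x <= N)%MS.
  rewrite submxE; apply/eqP/rowP=> k; rewrite [RHS]mxE.
  set c := col k (cokermx N).
  have Nc : N *m c = 0 by rewrite /c colE mulmxA mulmx_coker mul0mx.
  have /(congr1 f) := rel_gen_syzygy Nc.
  rewrite dual0 dual_sum => /(congr1 (@sgring_val K m n h)).
  rewrite raddf_sum raddf0 => E.
  (* Applying [f] to the syzygy gives summands that all have degree (B - h(v_i)) + (a + h(v_i)) = B
     + a. *)
  have /(congr1 (monalg.mcoeff (B + a))) :
    lterm (B + a) (\sum_i c i 0 * mu i) = 0 :> laurent K m.
    rewrite -E raddf_sum; apply: eq_bigr => i _.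
    rewrite [RHS]sgvalM syz_coefE muE lmulE lmulUU.
    by rewrite [a + _]addrC addrA subrK.
  rewrite mcoeff_lterm eqxx mulr1n raddf0 => E0; rewrite mxE -[RHS]E0.
  by apply: eq_bigr => i _; rewrite !mxE mulrC.
have /submxP[w wE] := xN; exists w; apply/representsE => i.
by rewrite muE -wE mxE.
Qed.

(** * The cokernel in degree a and its basis *)

Let I : {set 'I_s} := [set i | `[< ~ H (a + deg (v i)) >]].
Let J : {set 'I_n} := [set j | `[< H (a + h j) >]].
Let D := sel_cols K I.
(** [V1] collects the vectors A_H w of degree-a functionals on U, and [V2] those of functionals
    extending to the free module. *)
Let V1 := kermx (N *m D) *m N.
Let V2 := rowsub (fun k : 'I_#|J| => enum_val k) N.
Local Notation restr := (dual_map (val : U -> 'rV[R]_n)).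

Lemma represents_coker_eq0 w (f : dual U) : represents w f ->
  coker_pi restr f = 0 <-> (w *m N <= V2)%MS.
Proof.
move=> wf; split.
  rewrite -(raddf0 (coker_pi _)) => /coker_piP[g].
  rewrite subr0 => fg.
  pose G j := g (delta_mx 0 j).
  (* The extension [g] need not be homogeneous: only the coefficient of t^(a + h_j) in g(dx_j) is
     kept. It vanishes for j outside [J], since K[H] is supported in H. *)
  pose w' : 'rV[K]_n := \row_j monalg.mcoeff (a + h j) (sgring_val (G j)).
  apply/sub_rowsubP; exists w' => [j|].
    rewrite inE mxE => /asboolPn; exact: mcoeff_sgring_out.
  apply/rowP=> i.
  have := congr1 (fun x => monalg.mcoeff (a + deg (v i)) (sgring_val x))
    (congr1 (fun f : dual U => f (rel_gen i)) fg).
  rewrite (representsE w f).1 //.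
  rewrite mcoeff_lterm eqxx mulr1n => ->.
  have -> : restr g (rel_gen i) = \sum_j drel (v i) 0 j * G j.
    by rewrite /G -dual_sum -row_sum_delta.
  rewrite !raddf_sum mxE; apply: eq_bigr => j _.
  transitivity (monalg.mcoeff (a + deg (v i))
      (sgring_val (drel (v i) 0 j) * sgring_val (G j))).
    by rewrite -sgvalM.
  rewrite val_rel_differential // -[(v i 0 j)%:~R]mulr1 ltermZ -scalerAl.
  have -> : a + deg (v i) = (deg (v i) - h j) + (a + h j).
    by rewrite [RHS]addrACA addNr addr0 addrC.
  by rewrite monalg.mcoeffZ mcoeff_lmonoM !mxE mulrC.
(* Conversely, the pairing with a [w'] supported in [J] is defined on the whole free module, and it
   agrees with [f] on U because [w] and [w'] have the same image under [N]. *)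
case/sub_rowsubP=> w' w'J wN.
have w'R (x : 'rV[R]_n) : pairing w' x \in sgring_pred h.
  apply: rpred_sum => j _.
  suff jR : lterm (a + h j) (w' 0 j) \in sgring_pred h.
    exact: rpredM jR (sgring_valP _).
  have [jJ|/w'J->] := boolP (j \in J); last by rewrite raddf0 rpred0.
  rewrite inE in jJ; have /asboolP aH := jJ.
  by rewrite -[X in lterm _ X]mulr1 ltermZ rpredZ //; exact: lmono_semigroup.
pose g0 (x : 'rV[R]_n) : R^o := SgRing (w'R x).
have gP : g0 \in @dual_pred _ 'rV[R]_n.
  apply/asboolP=> c u z; apply: sgval_inj.
  by rewrite raddfD /= pairing_linearr.
rewrite -(raddf0 (coker_pi _)); apply/coker_piP; exists (Dual gP).
rewrite subr0; apply: (represents_uniq wf _ wN) => u.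
by [].
Qed.

(** If v_i(j) were nonzero, a + h(v_i) would be the sum of h(v_i) - h_j and a + h_j, both in H. *)
Lemma relation_matrix_block0 i j : i \in I -> j \in J ->
  map_mx intr (relation_matrix v) i j = 0 :> K.
Proof.
rewrite !inE => /asboolP niH /asboolP jH; rewrite !mxE.
have [->|vij] := eqVneq (v i 0 j) 0; first by rewrite mulr0z.
case: niH; rewrite -(subrK (h j) (deg (v i))) addrCA.
apply: in_semigroupD jH.
exact: (rel_degree_semigroup (vL i) vij).
Qed.

Lemma represents_kermx w (f : dual U) : represents w f ->
  (w <= kermx (N *m D))%MS.
Proof.
move/representsE => wf; apply/sub_kermxP; rewrite mulmxA.
apply/sel_colsP=> k i; rewrite inE => /asboolP niH.
have := mcoeff_sgring_out (f (rel_gen i)) niH.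
by rewrite wf mcoeff_lterm eqxx mulr1n (ord1 k).
Qed.

Lemma kermx_represents w : (w <= kermx (N *m D))%MS ->
  exists f : dual U, represents w f.
Proof.
move/sub_kermxP; rewrite mulmxA => /sel_colsP w0.
apply: represents_ex => i niH; apply: w0.
by rewrite inE; apply/asboolP.
Qed.

Lemma T1_component_dim :
  has_dim (T1_component (K := K) (h := h) a) (\rank (V1 :\: V2)).
Proof.
set B := (V1 :\: V2)%MS; set d := \rank B.
(* A basis of a complement of [V2] in [V1] is pulled back through [N] to vectors that represent
   functionals; their classes form the basis of T^1_a. *)
have /submxP[Y YE] : (row_base B <= V1)%MS.
  by rewrite eq_row_base diffmxSl.
pose W := Y *m kermx (N *m D).
have WN : W *m N = row_base B by rewrite YE /W -mulmxA.
have Wf i : exists f : dual U, represents (row i W) f.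
  by apply: kermx_represents; rewrite row_mul submxMl.
have [f fE] := choice Wf.
have comb (c : 'I_d -> K) :
    represents ((\row_i c i) *m W) (\sum_i (c i)%:A *: f i).
  have -> : (\row_i c i) *m W = \sum_i c i *: row i W.
    by rewrite mulmx_sum_row; apply: eq_bigr => i _; rewrite mxE.
  exact (represents_sum c fE).
exists (fun i => coker_pi restr (f i)); split=> [x|c].
  split=> [[g ga ->]|[c ->]].
    have [w wg] := homog_represents ga.
    have wV1 : (w *m N <= V1)%MS by rewrite submxMr ?(represents_kermx wg).
    have : (w *m N <= B + V2)%MS.
      have BV := addsmx_diff_cap_eq V1 V2.
      rewrite (submx_trans wV1) // -BV addsmxS //; exact: capmxSr.
    case/sub_addsmxP=> -[u1 u2] /= wE.
    have /submxP[c cE] : (u1 *m B <= row_base B)%MS.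
      by rewrite eq_row_base submxMl.
    exists (fun i => c 0 i).
    have cE' : \row_i c 0 i = c by apply/rowP=> i; rewrite mxE.
    (* Subtracting the component of [w *m N] in the complement leaves a vector of [V2], that is, a
       class that is zero in the cokernel. *)
    have wV2 : ((-1 *: ((\row_i c 0 i) *m W) + w) *m N <= V2)%MS.
      rewrite mulmxDl -scalemxAl -mulmxA WN cE' -cE scaleN1r wE addKr.
      exact: submxMl.
    have := represents_linear (-1) (comb (fun i => c 0 i)) wg.
    move/represents_coker_eq0 => [_ /(_ wV2)].
    rewrite coker_pi_linear coker_pi_sum scaleN1r scaleN1r.
    by move/eqP; rewrite addrC subr_eq0 => /eqP.
  exists (\sum_i (c i)%:A *: f i); last by rewrite coker_pi_sum.
  exact: represents_homog (comb c).
rewrite -coker_pi_sum => /(represents_coker_eq0 (comb c)).1 cV2 i.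
(* The combination lies both in the complement and in [V2], which meet trivially. *)
have : (\row_i c i) *m row_base B = 0.
  have cB : ((\row_i c i) *m row_base B <= B)%MS.
    by rewrite (submx_trans (submxMl _ _)) ?eq_row_base.
  apply/eqP; rewrite -submx0 -(capmx_diff V1 V2) sub_capmx cB /=.
  by rewrite -WN mulmxA.
move/(row_free_comb0 (row_base_free _))/rowP/(_ i).
by rewrite !mxE.
Qed.

End SemigroupAlgebra.

Theorem mainTheorem1 (K : fieldType) (charK0 : [pchar K] =i pred0)
    (m n s : nat) (h : 'I_n -> 'rV[int]_m) (hmin : minimal_generators h)
    (v : 'I_s -> 'rV[int]_n) (vL : forall i, relation_lattice h (v i))
    (vgen : generates_toric_ideal K h v)
    (a : 'rV[int]_m) (aZH : in_group h a) :
  let A_H := relation_matrix v in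
  let l := int_rank A_H in
  let l_a := int_rank
    (rows_of [set i | `[< ~ in_semigroup h (a + rel_degree h (v i)) >]] A_H) in
  let d_a := int_rank
    (cols_of [set j | `[< in_semigroup h (a + h j) >]] A_H) in
  exists d : nat,
    has_dim (T1_component (K := K) (h := h) a) d /\
    d%:Z = l%:Z - l_a%:Z - d_a%:Z.
Proof.
move=> A_H l l_a d_a.
have := mxrank_diff_formula (relation_matrix_block0 K (a := a) vL).
set d := \rank (_ :\: _)%MS => dE; exists d; split.
  exact: T1_component_dim.
(* The three ranks over K become the rational ranks of the statement. *)
move: dE; rewrite -!map_mxsub !mxrank_intr_pchar0 //.
rewrite -[int_rank (rowsub _ _)]/l_a -[int_rank (colsub _ _)]/d_a.
rewrite -[int_rank (relation_matrix v)]/l; lia.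
Qed.
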